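(* Let $i\neq j$ be two agents, let $s_t$ be a state, and let $a_t^i,a_t^j$ be the actions of the two agents at time $t$, with joint conditional distribution $$p(a_t^i,a_t^j|s_t)=\int \pi^i(a_t^i|s_t,z_t)\,\pi^j(a_t^j|s_t,z_t)\,p_Z(z_t)\,dz_t,$$ where $z_t$ is a latent variable with prior distribution $p_Z$, shared by the two agents. Let $q(a_t^j|a_t^i,s_t)$ and $q(a_t^i|a_t^j,s_t)$ be variational conditional distributions (approximating $p(a_t^j|a_t^i,s_t)$ and $p(a_t^i|a_t^j,s_t)$). Then the mutual information between $a_t^i$ and $a_t^j$ given $s_t$ satisfies $$I(a_t^i;a_t^j|s_t)\;\ge\;\frac12\Big\{H(a_t^i|s_t)+H(a_t^j|s_t)+\mathbb{E}_{p(a_t^i,a_t^j|s_t)}\big[\log q(a_t^j|a_t^i,s_t)+\log q(a_t^i|a_t^j,s_t)\big]\Big\}.$$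
   Context: Agent $k$ has a policy $\pi^k(a^k|s,z)$, a conditional distribution (density) of its action $a^k$ given the state $s$ and the latent variable $z$. Given $s$ and $z$, the actions of different agents are drawn independently from their policies. The marginal distribution of agent $k$'s action given $s$ is $p(a^k|s)=\tilde\pi^k(a^k|s)=\int \pi^k(a^k|s,z)\,p_Z(z)\,dz$. The entropy $H(a^k|s)=-\int p(a^k|s)\log p(a^k|s)\,da^k$ is the entropy of this marginal for the given state $s$. The mutual information for the given state $s$ is $$I(a^i;a^j|s)=\int p(a^i,a^j|s)\log\frac{p(a^i,a^j|s)}{p(a^i|s)\,p(a^j|s)}\,da^i\,da^j.$$ The variational distribution $q(a^j|a^i,s)$ is a conditional probability distribution of $a^j$ given $(a^i,s)$, taken from some class $\mathcal{Q}$ of distributions; similarly for $q(a^i|a^j,s)$. For discrete actions, integrals over actions are read as sums. *)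

(* Defs.v *)
From HB Require Import structures.
From mathcomp Require Import all_boot all_order all_algebra.
From mathcomp Require Import all_classical all_reals all_analysis.

Set Implicit Arguments.
Unset Strict Implicit.
Unset Printing Implicit Defensive.

Import Order.TTheory GRing.Theory Num.Theory.
Local Open Scope classical_set_scope.
Local Open Scope ring_scope.
Local Open Scope ereal_scope.

(* Each action space carries a sigma-finite reference measure with respect to
   which densities and integrals "da" are taken: Lebesgue measure for
   continuous actions, counting measure for discrete ones (integrals are then
   sums).
   Logarithms are extended-valued ([lne 0 = -oo]), so that a variational
   density vanishing where p > 0 contributes -oo to the expectation.  Since
   [0 * -oo = 0] in [\bar R], the usual convention 0 log 0 = 0 holds.  An
   integral whose positive and negative parts are both infinite evaluates to
   [+oo - +oo = -oo]. *)

Record cond_density (R : realType) dX dY (X : measurableType dX)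
    (Y : measurableType dY) (mu : {measure set Y -> \bar R})
    (f : X -> Y -> R) : Prop := CondDensity {
  cond_density_measurable :
    measurable_fun [set: X * Y] (fun xy : X * Y => f xy.1 xy.2) ;
  cond_density_ge0 : forall x y, (0 <= f x y)%R ;
  cond_density_norm : forall x, \int[mu]_y (f x y)%:E = 1
}.

Section latent.
Context (R : realType) (dZ d1 d2 : measure_display) (Z : measurableType dZ)
  (A1 : measurableType d1) (A2 : measurableType d2) (pZ : probability Z R).

Definition marginal_density (f : Z -> A1 -> R) (a : A1) : \bar R :=
  \int[pZ]_z (f z a)%:E.

Definition joint_density (f : Z -> A1 -> R) (g : Z -> A2 -> R)
    (a : A1 * A2) : \bar R :=
  \int[pZ]_z (f z a.1 * g z a.2)%:E.

End latent.

Section information.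
Context (R : realType).

Definition entropy d (A : measurableType d)
    (mu : {sigma_finite_measure set A -> \bar R}) (p : A -> \bar R) : \bar R :=
  - \int[mu]_a (p a * lne (p a)).

(* The integral defining [entropy mu p] makes sense, possibly with an infinite
   value. This always holds for a discrete distribution, as p log p <= 0. *)
Definition entropy_exists d (A : measurableType d)
    (mu : {sigma_finite_measure set A -> \bar R}) (p : A -> \bar R) : Prop :=
  let h := fun a => p a * lne (p a) in
  \int[mu]_a h^\+ a < +oo \/ \int[mu]_a h^\- a < +oo.

Definition mutual_information d1 d2 (A1 : measurableType d1)
    (A2 : measurableType d2) (mu1 : {sigma_finite_measure set A1 -> \bar R})
    (mu2 : {sigma_finite_measure set A2 -> \bar R})
    (p : A1 * A2 -> \bar R) (p1 : A1 -> \bar R) (p2 : A2 -> \bar R) : \bar R :=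
  \int[mu1 \x mu2]_a (p a * lne (p a / (p1 a.1 * p2 a.2))).

Definition expectation_density d (A : measurableType d)
    (mu : {measure set A -> \bar R}) (p : A -> \bar R) (f : A -> \bar R) :
    \bar R :=
  \int[mu]_a (p a * f a).

End information.

(* Main.v *)
Require Import Defs.
From HB Require Import structures.
From mathcomp Require Import all_boot all_order all_algebra.
From mathcomp Require Import all_classical all_reals all_analysis measurable_realfun.
From mathcomp Require Import lra ring.

Set Implicit Arguments.
Unset Strict Implicit.
Unset Printing Implicit Defensive.

Import Order.TTheory GRing.Theory Num.Theory.
Local Open Scope classical_set_scope.
Local Open Scope ring_scope.
Local Open Scope ereal_scope.

(* Write p for the joint density, p1 and p2 for its marginals, I for the mutual
   information and q(b|a) for a variational kernel. Since [ln x <= x - 1] at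
   x = q p1 / p,
     p log q <= p log (p / (p1 p2)) + p log p2 + (q p1 - p),
   and integrating gives E[log q(b|a)] <= I - H(b), because the last bracket has
   integral 1 - 1 = 0. The same bound with the two agents exchanged, added to
   this one, is the theorem.
   Infinite values: if I = +oo or one of the entropies is -oo there is nothing to
   prove. Otherwise the three summands above have integrable positive parts, and
   on such functions the integral, with values in [-oo, +oo), is subadditive; in
   particular H(b) = +oo forces E[log q(b|a)] = -oo. *)

(** * Measurability of the inverse and of the extended logarithm *)

Section extended_real_functions.
Context (R : realType).

Lemma measurable_invr : measurable_fun [set: R] (@GRing.inv R).
Proof.
(* This is x / x^2: the square puts the argument of [ln] in the positive range for x != 0, and the
   factor x gives the default value 0 at x = 0. *)
have -> : @GRing.inv R = (fun x => x * expR (- ln (x ^+ 2)))%R.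
  apply/funext => x; have [->|x0] := eqVneq x 0%R; first by rewrite invr0 mul0r.
  rewrite -lnV ?posrE ?exprn_even_gt0// lnK ?posrE ?invr_gt0 ?exprn_even_gt0//.
  by rewrite expr2 invfM mulrA divff// mul1r.
apply: measurable_funM => //; apply: measurableT_comp => //.
apply: measurableT_comp => //; apply: measurableT_comp; first exact: measurable_ln.
exact: measurable_funX.
Qed.

Lemma measurable_inve : measurable_fun [set: \bar R] (@inve R).
Proof.
(* The default values matter here: the inverse of 0 is +oo and that of -oo is -oo. *)
have -> : @inve R = (fun x => if x == +oo then 0 else if x == -oo then -oo
    else if x == 0 then +oo else ((fine x)^-1)%:E).
  by apply/funext => -[r| |] //=; rewrite inver.
have mT (c : \bar R) : measurable_fun setT (fun x : \bar R => x == c).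
  exact: measurable_fun_eqe.
do 3 apply: measurable_fun_ifT => //.
by apply/measurable_EFinP; apply: measurableT_comp measurable_invr _.
Qed.

Lemma measurable_lne : measurable_fun [set: \bar R] (@lne R).
Proof.
have -> : @lne R = (fun x => if x == +oo then +oo else if x <= 0 then -oo
    else (ln (fine x))%:E).
  by apply/funext => -[r| |]; rewrite ?leNye ?lee_fin.
apply: measurable_fun_ifT => //; first exact: measurable_fun_eqe.
apply: measurable_fun_ifT => //; first exact: measurable_fun_lee.
by apply/measurable_EFinP; apply: measurableT_comp (@measurable_ln R) _.
Qed.

Lemma ln_le_subr1 (x : R) : (0 < x)%R -> (ln x <= x - 1)%R.
Proof.
move=> x0; have := @le_ln1Dx R (x - 1)%R.
by rewrite [(1 + _)%R]addrC subrK; apply; rewrite ltrBrDr addNr.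
Qed.

End extended_real_functions.

(** * Integrals with values in [-oo, +oo) *)

Section quasi_integrable.
Context (R : realType) d (T : measurableType d).
Variable mu : {measure set T -> \bar R}.
Implicit Types f g : T -> \bar R.

(** Only the positive part is controlled, because p log q and p log p2 may have integral -oo, which
    ordinary integrability would exclude. *)
Definition upper_integrable f :=
  measurable_fun setT f /\ \int[mu]_x f^\+ x < +oo.

(* With [+oo - +oo = -oo] this identity holds for all extended values. *)
Lemma adde_pos_neg (a b : \bar R) :
  maxe (a + b) 0 + (maxe (- a) 0 + maxe (- b) 0) =
  maxe (- (a + b)) 0 + (maxe a 0 + maxe b 0).
Proof.
(* Trading negative parts for positive ones turns the finite case into a ring identity. *)
have E (x : R) : (Num.max (- x) 0 = Num.max x 0 - x)%R.
  by rewrite !maxEle; case: ifP; case: ifP; lra.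
case: a b => [a| |] [b| |] //=; rewrite ?maxey ?maxye ?maxNye ?maxeNy //=.
all: rewrite -?EFin_max -?EFinD ?E ?add0e ?adde0 ?addey ?addye //.
by congr EFin; ring.
Qed.

(** Integrating [adde_pos_neg] gives an equation between nonnegative integrals. The positive parts
    have finite integrals, so it can be solved for the integral of the sum; an infinite integral of
    [f^\-] or [g^\-] forces that of [(f \+ g)^\-] to be infinite, and both sides are then -oo. *)
Lemma upper_integrableD f g : upper_integrable f -> upper_integrable g ->
  upper_integrable (f \+ g) /\
  \int[mu]_x (f x + g x) <= \int[mu]_x f x + \int[mu]_x g x.
Proof.
move=> [mf If] [mg Ig].
have mfg : measurable_fun setT (f \+ g) by exact: emeasurable_funD.
have mp (h : T -> \bar R) : measurable_fun setT h -> measurable_fun setT h^\+.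
  exact: measurable_funepos.
have mn (h : T -> \bar R) : measurable_fun setT h -> measurable_fun setT h^\-.
  exact: measurable_funeneg.
have Ifg : \int[mu]_x (f \+ g)^\+ x < +oo.
  apply: (@le_lt_trans _ _ (\int[mu]_x (f^\+ x + g^\+ x))).
    apply: ge0_le_integral => //; first exact: mp.
      by apply: emeasurable_funD; exact: mp.
    move=> x _; rewrite !funeposE ge_max adde_ge0 ?le_max ?lexx ?orbT// andbT.
    by apply: leeD; rewrite le_max lexx.
  rewrite ge0_integralD//; [exact: lte_add_pinfty|exact: mp|exact: mp].
split; first by [].
have : \int[mu]_x (f \+ g)^\+ x + (\int[mu]_x f^\- x + \int[mu]_x g^\- x) =
       \int[mu]_x (f \+ g)^\- x + (\int[mu]_x f^\+ x + \int[mu]_x g^\+ x).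
  rewrite -!ge0_integralD//; try by [exact: mp|exact: mn|move=> *; exact: adde_ge0|
   apply: emeasurable_funD; [exact: mp|exact: mp]|apply: emeasurable_funD; [exact: mn|exact: mn]].
  by apply: eq_integral => x _; rewrite !funeposE !funenegE adde_pos_neg.
rewrite [leLHS]integralE [\int[mu]_x f x]integralE [\int[mu]_x g x]integralE.
have ge0 h : 0 <= \int[mu]_x h^\+ x by exact: integral_ge0.
have ge0' h : 0 <= \int[mu]_x h^\- x by exact: integral_ge0.
move: (ge0 f) (ge0 g) (ge0 (f \+ g)) (ge0' f) (ge0' g) (ge0' (f \+ g)) If Ig Ifg.
case: (\int[mu]_x f^\+ x) => // a; case: (\int[mu]_x g^\+ x) => // b.
case: (\int[mu]_x (f \+ g)^\+ x) => // c _ _ _.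
case: (\int[mu]_x f^\- x) => [a'| |]//; case: (\int[mu]_x g^\- x) => [b'| |]//;
case: (\int[mu]_x (f \+ g)^\- x) => [c'| |]//= _ _ _ _ _ _.
by move=> -[?]; rewrite lee_fin; lra.
Qed.

(** Almost everywhere the positive parts are ordered like f and g and the negative parts in reverse;
    extended subtraction respects this even with +oo - +oo = -oo. *)
Lemma ae_le_integral f g : measurable_fun setT f -> measurable_fun setT g ->
  {ae mu, forall x, f x <= g x} -> \int[mu]_x f x <= \int[mu]_x g x.
Proof.
move=> mf mg fg; rewrite [leLHS]integralE [leRHS]integralE; apply: leeB.
- apply: ae_ge0_le_integral => //; [exact: measurable_funepos..|].
  apply: filterS fg => x fg _.
  by rewrite !funeposE ge_max !le_max fg lexx orbT.
- apply: ae_ge0_le_integral => //; [exact: measurable_funeneg..|].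
  apply: filterS fg => x fg _.
  by rewrite !funenegE ge_max !le_max leeN2 fg lexx orbT.
Qed.

End quasi_integrable.

Lemma upper_integrable_ae_le (R : realType) d (T : measurableType d)
    (mu : {measure set T -> \bar R}) (f g : T -> \bar R) :
  measurable_fun setT f -> upper_integrable mu g ->
  {ae mu, forall x, f x <= g x} -> upper_integrable mu f.
Proof.
move=> mf [mg Ig] fg; split => //; apply: le_lt_trans Ig.
apply: ae_ge0_le_integral => //; [exact: measurable_funepos..|].
apply: filterS fg => x fg _.
by rewrite !funeposE ge_max !le_max fg lexx orbT.
Qed.

(** * Product measures, null sets and almost everywhere finiteness *)

Lemma integral_swap (R : realType) d1 d2 (A1 : measurableType d1)
    (A2 : measurableType d2) (mu1 : {sigma_finite_measure set A1 -> \bar R})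
    (mu2 : {sigma_finite_measure set A2 -> \bar R}) (f : A1 * A2 -> \bar R) :
  measurable_fun setT f ->
  \int[mu2 \x mu1]_b f (b.2, b.1) = \int[mu1 \x mu2]_a f a.
Proof.
(* Tonelli settles nonnegative functions; positive and negative parts then give the general case,
   infinite integrals included. *)
have ge0 (g : A1 * A2 -> \bar R) : measurable_fun setT g ->
    (forall a, 0 <= g a) ->
    \int[mu2 \x mu1]_b g (b.2, b.1) = \int[mu1 \x mu2]_a g a.
  move=> mg g0; rewrite (fubini_tonelli1 (fun b => g (b.2, b.1)))//; last first.
    exact: (measurableT_comp mg (@measurable_swap _ _ A2 A1)).
  by rewrite (fubini_tonelli2 g).
move=> mf; rewrite integralE [RHS]integralE; congr (_ - _).
  rewrite -ge0//; first by apply: eq_integral => b _; rewrite !funeposE.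
  exact: measurable_funepos.
rewrite -ge0//; first by apply: eq_integral => b _; rewrite !funenegE.
exact: measurable_funeneg.
Qed.

(** The exceptional set lies in a cylinder over a null set, of measure 0 * mu2(A2) = 0 even when
    [mu2] is infinite. *)
Lemma ae_product_fst (R : realType) d1 d2 (A1 : measurableType d1)
    (A2 : measurableType d2) (mu1 : {sigma_finite_measure set A1 -> \bar R})
    (mu2 : {sigma_finite_measure set A2 -> \bar R}) (P : A1 -> Prop) :
  {ae mu1, forall x, P x} -> {ae mu1 \x mu2, forall a, P a.1}.
Proof.
move=> [N [mN N0 PN]]; exists (N `*` setT); split.
- exact: measurableX.
- by rewrite /= product_measure1E// [X in X * _](_ : _ = 0) ?mul0e.
- by move=> [a b] /= nP; split => //; exact: PN.
Qed.

Lemma ae_product_snd (R : realType) d1 d2 (A1 : measurableType d1)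
    (A2 : measurableType d2) (mu1 : {sigma_finite_measure set A1 -> \bar R})
    (mu2 : {sigma_finite_measure set A2 -> \bar R}) (P : A2 -> Prop) :
  {ae mu2, forall x, P x} -> {ae mu1 \x mu2, forall a, P a.2}.
Proof.
move=> [N [mN N0 PN]]; exists (setT `*` N); split.
- exact: measurableX.
- by rewrite /= product_measure1E// [X in _ * X](_ : _ = 0) ?mule0.
- by move=> [a b] /= nP; split => //; exact: PN.
Qed.

Lemma ae_fin_num (R : realType) d (T : measurableType d)
    (mu : {measure set T -> \bar R}) (f : T -> \bar R) :
  measurable_fun setT f -> (forall x, 0 <= f x) -> \int[mu]_x f x < +oo ->
  {ae mu, forall x, f x \is a fin_num}.
Proof.
move=> mf f0 If.
have /(integrable_ae measurableT) : mu.-integrable setT f.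
  apply/integrableP; split => //.
  by under eq_integral => x _ do rewrite gee0_abs//.
by move=> fin_f; apply: filterS fin_f => x; exact.
Qed.

(** * Pointwise inequalities between densities *)

Section pointwise.
Context (R : realType).

Lemma gt0_of_dominates (p r : R) :
  p != 0%R -> (0 <= r)%R -> (r%:E = 0 -> p%:E = 0) -> (0 < r)%R.
Proof.
move=> p0 r0 rp; rewrite lt_neqAle r0 andbT eq_sym; apply: contra_neq p0 => r00.
by have [->] := rp (congr1 EFin r00).
Qed.

(** This is ln x <= x - 1 at x = p1 p2 / p. It serves to bound the negative part of the information
    integrand by p1 p2. *)
Lemma mul_lne_div_ge (p p1 p2 : \bar R) :
    p \is a fin_num -> p1 \is a fin_num -> p2 \is a fin_num ->
    0 <= p -> 0 <= p1 -> 0 <= p2 -> (p1 = 0 -> p = 0) -> (p2 = 0 -> p = 0) ->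
  p - p1 * p2 <= p * lne (p / (p1 * p2)).
Proof.
case: p p1 p2 => [p| |] [p1| |] [p2| |] // _ _ _; rewrite !lee_fin => p0 p10 p20.
have [->|p_neq0] := eqVneq p 0%R.
  by move=> _ _; rewrite mul0e sub0e oppe_le0 -EFinM lee_fin mulr_ge0.
move=> a1 a2.
have p_gt0 : (0 < p)%R by rewrite lt_neqAle eq_sym p_neq0.
have p1_gt0 := gt0_of_dominates p_neq0 p10 a1.
have p2_gt0 := gt0_of_dominates p_neq0 p20 a2.
have p12 : (0 < p1 * p2)%R by rewrite mulr_gt0.
rewrite -EFinM inver gt_eqF// -EFinM lne_EFin ?divr_gt0// -EFinM -EFinB lee_fin.
have := @ln_le_subr1 R (p1 * p2 / p)%R (divr_gt0 p12 p_gt0).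
rewrite -[(p / (p1 * p2))%R]invf_div lnV ?posrE ?divr_gt0// mulrN.
move=> /(ler_wpM2l p0); rewrite mulrBr mulr1 mulrCA divff// mulr1; lra.
Qed.

(** The degenerate cases fit the conventions: for p = 0 it reads 0 <= p1 q, and for q = 0 < p the
    left-hand side is -oo. Otherwise domination makes p1 and p2 positive and all logarithms are
    finite. *)
Lemma mul_lne_le (p p1 p2 : \bar R) (q : R) :
    p \is a fin_num -> p1 \is a fin_num -> p2 \is a fin_num -> (0 <= q)%R ->
    0 <= p -> 0 <= p1 -> 0 <= p2 -> (p1 = 0 -> p = 0) -> (p2 = 0 -> p = 0) ->
  p * lne q%:E <=
  p * lne (p / (p1 * p2)) + p * lne p2 + (p1 * q%:E - p).
Proof.
case: p p1 p2 => [p| |] [p1| |] [p2| |] // _ _ _ q0.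
rewrite !lee_fin => p0 p10 p20.
have [->|p_neq0] := eqVneq p 0%R.
  by move=> _ _; rewrite !mul0e !add0e sube0 -EFinM lee_fin mulr_ge0.
move=> a1 a2.
have p_gt0 : (0 < p)%R by rewrite lt_neqAle eq_sym p_neq0.
have p1_gt0 := gt0_of_dominates p_neq0 p10 a1.
have p2_gt0 := gt0_of_dominates p_neq0 p20 a2.
have [->|q_neq0] := eqVneq q 0%R.
  by rewrite le0_lneNy// gt0_muleNy ?lte_fin// leNye.
have q_gt0 : (0 < q)%R by rewrite lt_neqAle eq_sym q_neq0.
have p12 : (0 < p1 * p2)%R by rewrite mulr_gt0.
rewrite -EFinM inver gt_eqF// -EFinM !lne_EFin ?divr_gt0// -!EFinM -EFinB.
rewrite -!EFinD lee_fin.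
have := @ln_le_subr1 R (p1 * q / p)%R (divr_gt0 (mulr_gt0 p1_gt0 q_gt0) p_gt0).
rewrite !ln_div ?posrE ?mulr_gt0// !lnM ?posrE//.
move=> /(ler_wpM2l p0); rewrite [in X in (_ <= X)%R -> _]mulrBr mulr1 mulrCA divff// mulr1.
by rewrite !(mulrBr, mulrDr); lra.
Qed.

End pointwise.

(** * Marginal and joint densities of two agents *)

Lemma marginal_density_ge0 (R : realType) dZ d (Z : measurableType dZ)
    (A : measurableType d) (pZ : probability Z R)
    (mu : {measure set A -> \bar R}) (f : Z -> A -> R) (a : A) :
  cond_density mu f -> 0 <= marginal_density pZ f a.
Proof.
by move=> hf; apply: integral_ge0 => z _; rewrite lee_fin; case: hf.
Qed.

Lemma measurable_marginal_density (R : realType) dZ d (Z : measurableType dZ)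
    (A : measurableType d) (pZ : probability Z R)
    (mu : {measure set A -> \bar R}) (f : Z -> A -> R) :
  cond_density mu f -> measurable_fun setT (marginal_density pZ f).
Proof.
move=> [mf f0 _].
apply: (measurable_fun_fubini_tonelli_G (fun za : Z * A => (f za.1 za.2)%:E)).
  exact/measurable_EFinP.
by move=> za; rewrite lee_fin.
Qed.

Lemma integral_marginal_density (R : realType) dZ d (Z : measurableType dZ)
    (A : measurableType d) (pZ : probability Z R)
    (mu : {sigma_finite_measure set A -> \bar R}) (f : Z -> A -> R) :
  cond_density mu f -> \int[mu]_a marginal_density pZ f a = 1.
Proof.
move=> [mf f0 f1].
rewrite -(fubini_tonelli (fun za : Z * A => (f za.1 za.2)%:E)); first last.
- by move=> za; rewrite lee_fin.
- exact/measurable_EFinP.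
under eq_integral => z _ do rewrite /= f1.
by rewrite integral_cst// mul1e; exact: probability_setT.
Qed.

Lemma joint_density_swap (R : realType) dZ d1 d2 (Z : measurableType dZ)
    (A1 : measurableType d1) (A2 : measurableType d2) (pZ : probability Z R)
    (f : Z -> A1 -> R) (g : Z -> A2 -> R) (b : A2 * A1) :
  joint_density pZ f g (b.2, b.1) = joint_density pZ g f b.
Proof. by apply: eq_integral => z _ /=; rewrite mulrC. Qed.

Section two_agents.
Context (R : realType) dZ d1 d2 (Z : measurableType dZ)
  (A1 : measurableType d1) (A2 : measurableType d2) (pZ : probability Z R).
Variables (mu1 : {sigma_finite_measure set A1 -> \bar R})
  (mu2 : {sigma_finite_measure set A2 -> \bar R}).
Variables (f : Z -> A1 -> R) (g : Z -> A2 -> R).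
Hypotheses (hf : cond_density mu1 f) (hg : cond_density mu2 g).

Let p := joint_density pZ f g.
Let p1 := marginal_density pZ f.
Let p2 := marginal_density pZ g.

Lemma joint_density_ge0 a : 0 <= p a.
Proof.
apply: integral_ge0 => z _; rewrite lee_fin mulr_ge0//;
  [exact: cond_density_ge0 hf _ _|exact: cond_density_ge0 hg _ _].
Qed.

Lemma measurable_joint_integrand :
  measurable_fun setT (fun za : Z * (A1 * A2) =>
    (f za.1 za.2.1 * g za.1 za.2.2)%:E).
Proof.
apply/measurable_EFinP; apply: measurable_funM.
- apply: (measurableT_comp (cond_density_measurable hf)
    (g := fun za : Z * (A1 * A2) => (za.1, za.2.1))).
  apply: measurable_fun_pair => //.
  exact: measurableT_comp.
- apply: (measurableT_comp (cond_density_measurable hg)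
    (g := fun za : Z * (A1 * A2) => (za.1, za.2.2))).
  apply: measurable_fun_pair => //.
  exact: measurableT_comp.
Qed.

Lemma measurable_joint_density : measurable_fun setT p.
Proof.
apply: (measurable_fun_fubini_tonelli_G
  (fun za : Z * (A1 * A2) => (f za.1 za.2.1 * g za.1 za.2.2)%:E)).
  exact: measurable_joint_integrand.
move=> za; rewrite lee_fin mulr_ge0//;
  [exact: cond_density_ge0 hf _ _|exact: cond_density_ge0 hg _ _].
Qed.

(** Conditional independence given z enters here: after Tonelli the factor f(z, a) leaves the
    integral over b, and g(z, .) integrates to 1. *)
Lemma integral_joint_density_fiber a : \int[mu2]_b p (a, b) = p1 a.
Proof.
rewrite /p /joint_density /=.
rewrite -(fubini_tonelli (fun zb : Z * A2 => (f zb.1 a * g zb.1 zb.2)%:E)).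
- apply: eq_integral => z _ /=.
  under eq_integral => b _ do rewrite EFinM.
  rewrite ge0_integralZl_EFin//.
  + by rewrite (cond_density_norm hg) mule1.
  + by move=> b _; rewrite lee_fin; exact: cond_density_ge0 hg _ _.
  + apply/measurable_EFinP.
    exact: (measurable_fun_pair2 z (cond_density_measurable hg)).
  + exact: cond_density_ge0 hf _ _.
- apply/measurable_EFinP; apply: measurable_funM.
    apply: (measurableT_comp (f := f^~ a)) => //.
    exact: (measurable_fun_pair1 a (cond_density_measurable hf)).
  exact: cond_density_measurable hg.
- move=> zb; rewrite lee_fin mulr_ge0//;
  [exact: cond_density_ge0 hf _ _|exact: cond_density_ge0 hg _ _].
Qed.

(** A nonnegative function of z with zero integral vanishes for almost every z, hence so does its
    product with g. This gives the domination that the pointwise inequalities assume, at every point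
    a. *)
Lemma joint_density_eq0 a : p1 a.1 = 0 -> p a = 0.
Proof.
move=> p10.
have mfa : measurable_fun setT (EFin \o f^~ a.1).
  by apply/measurable_EFinP;
    exact: (measurable_fun_pair1 a.1 (cond_density_measurable hf)).
have /(ae_eq_integral_abs pZ measurableT mfa) f0 :
    \int[pZ]_z `|(f z a.1)%:E| = 0.
  rewrite -[RHS]p10; apply: eq_integral => z _.
  by rewrite gee0_abs// lee_fin; exact: cond_density_ge0 hf _ _.
rewrite /p /joint_density (ae_eq_integral (cst 0)) ?integral0//.
- exact: (measurable_fun_pair1 a measurable_joint_integrand).
- apply: filterS f0 => z /(_ I) /= [->]; by rewrite mul0r.
Qed.

Lemma ge0_expectation_marginal_fst (phi : A1 -> \bar R) :
  measurable_fun setT phi -> (forall a, 0 <= phi a) ->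
  \int[mu1 \x mu2]_a (p a * phi a.1) = \int[mu1]_a (p1 a * phi a).
Proof.
move=> mphi phi0; rewrite fubini_tonelli1; first last.
- by move=> a; rewrite mule_ge0// joint_density_ge0.
- apply: emeasurable_funM; first exact: measurable_joint_density.
  exact: measurableT_comp.
apply: eq_integral => a _; rewrite /fubini_F /= ge0_integralZr//.
- by rewrite integral_joint_density_fiber.
- exact: (measurable_fun_pair2 a measurable_joint_density).
- by move=> b _; exact: joint_density_ge0.
Qed.

Lemma integral_joint_density : \int[mu1 \x mu2]_a p a = 1.
Proof.
under eq_integral => a _ do rewrite -[p a]mule1.
rewrite (@ge0_expectation_marginal_fst (cst 1))//.
under eq_integral => a _ do rewrite mule1.
exact: integral_marginal_density.
Qed.

(** Serves for both masses equal to 1: that of p1 q, with k the variational kernel, and that of p1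
    p2, with k = p2. *)
Lemma integral_marginal_mul_kernel (k : A1 * A2 -> \bar R) :
    measurable_fun setT k -> (forall a, 0 <= k a) ->
    (forall a, \int[mu2]_b k (a, b) = 1) ->
  \int[mu1 \x mu2]_a (p1 a.1 * k a) = 1.
Proof.
move=> mk k0 k1; rewrite fubini_tonelli1; first last.
- by move=> a; rewrite mule_ge0// (marginal_density_ge0 _ _ hf).
- apply: emeasurable_funM => //; apply: measurableT_comp => //.
  exact: measurable_marginal_density hf.
rewrite -(integral_marginal_density pZ hf).
apply: eq_integral => a _; rewrite /fubini_F /= ge0_integralZl//.
- by rewrite k1 mule1.
- exact: (measurable_fun_pair2 a mk).
- exact: marginal_density_ge0 hf.
Qed.

End two_agents.

(** * Expectations of signed functions of one action *)

Lemma maxe_ge0_mull (R : realType) (x y : \bar R) :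
  0 <= x -> maxe (x * y) 0 = x * maxe y 0.
Proof.
move=> x0; have [y0|/ltW y0] := leP 0 y.
  by rewrite !max_l// mule_ge0.
by rewrite !max_r ?mule0// mule_ge0_le0.
Qed.

Section marginal_expectation.
Context (R : realType) dZ d1 d2 (Z : measurableType dZ)
  (A1 : measurableType d1) (A2 : measurableType d2) (pZ : probability Z R).

(** The weights are nonnegative, so the parts of p phi are p times the parts of phi, and the
    nonnegative case applies to each. The positive parts appear separately because they carry upper
    integrability to the product space. *)
Lemma expectation_marginal_fst (mu1 : {sigma_finite_measure set A1 -> \bar R})
    (mu2 : {sigma_finite_measure set A2 -> \bar R})
    (f : Z -> A1 -> R) (g : Z -> A2 -> R) (phi : A1 -> \bar R) :
    cond_density mu1 f -> cond_density mu2 g -> measurable_fun setT phi ->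
  let h a := joint_density pZ f g a * phi a.1 in
  let h1 a := marginal_density pZ f a * phi a in
  \int[mu1 \x mu2]_a h^\+ a = \int[mu1]_a h1^\+ a /\
  \int[mu1 \x mu2]_a h a = \int[mu1]_a h1 a.
Proof.
move=> hf hg mphi h h1.
have p0 := joint_density_ge0 pZ hf hg.
have p10 a := marginal_density_ge0 pZ a hf.
have pos : \int[mu1 \x mu2]_a h^\+ a = \int[mu1]_a h1^\+ a.
  under eq_integral do rewrite funeposE maxe_ge0_mull//.
  under [RHS]eq_integral do rewrite funeposE maxe_ge0_mull//.
  apply: (ge0_expectation_marginal_fst pZ hf hg
    (phi := fun a => maxe (phi a) 0)) => [|a]; last by rewrite le_max lexx orbT.
  exact: measurable_maxe.
split=> //; rewrite integralE [RHS]integralE pos; congr (_ - _).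
under eq_integral do rewrite funenegE -muleN maxe_ge0_mull//.
under [RHS]eq_integral do rewrite funenegE -muleN maxe_ge0_mull//.
apply: (ge0_expectation_marginal_fst pZ hf hg
  (phi := fun a => maxe (- phi a) 0)) => [|a]; last by rewrite le_max lexx orbT.
by apply: measurable_maxe => //; exact: measurableT_comp.
Qed.

End marginal_expectation.

(** * The variational bound for one conditional kernel *)

Section one_sided_bound.
Context (R : realType) dZ d1 d2 (Z : measurableType dZ)
  (A1 : measurableType d1) (A2 : measurableType d2) (pZ : probability Z R).
Variables (mu1 : {sigma_finite_measure set A1 -> \bar R})
  (mu2 : {sigma_finite_measure set A2 -> \bar R}).
Variables (f : Z -> A1 -> R) (g : Z -> A2 -> R).
Hypotheses (hf : cond_density mu1 f) (hg : cond_density mu2 g).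

Let p := joint_density pZ f g.
Let p1 := marginal_density pZ f.
Let p2 := marginal_density pZ g.
Let h2 b := p2 b * lne (p2 b).
Let J (a : A1 * A2) := p a * lne (p a / (p1 a.1 * p2 a.2)).

Let p0 a : 0 <= p a := joint_density_ge0 pZ hf hg a.
Let p10 a : 0 <= p1 a := marginal_density_ge0 pZ a hf.
Let p20 b : 0 <= p2 b := marginal_density_ge0 pZ b hg.
Let mp : measurable_fun setT p := measurable_joint_density pZ hf hg.
Let mp1 : measurable_fun setT p1 := measurable_marginal_density pZ hf.
Let mp2 : measurable_fun setT p2 := measurable_marginal_density pZ hg.

Let mp1fst : measurable_fun setT (fun a : A1 * A2 => p1 a.1).
Proof. exact: measurableT_comp. Qed.

Let mp2snd : measurable_fun setT (fun a : A1 * A2 => p2 a.2).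
Proof. exact: measurableT_comp. Qed.

Lemma joint_density_eq0_snd a : p2 a.2 = 0 -> p a = 0.
Proof.
move=> p2a; rewrite /p -joint_density_swap.
exact: (joint_density_eq0 hg hf (a := (a.2, a.1))) p2a.
Qed.

Lemma expectation_marginal_snd (phi : A2 -> \bar R) :
  measurable_fun setT phi ->
  let h a := p a * phi a.2 in
  let k b := p2 b * phi b in
  \int[mu1 \x mu2]_a h^\+ a = \int[mu2]_a k^\+ a /\
  \int[mu1 \x mu2]_a h a = \int[mu2]_a k a.
Proof.
move=> mphi h k.
have mh : measurable_fun setT h.
  by apply: emeasurable_funM => //; exact: measurableT_comp.
have [pos tot] := expectation_marginal_fst pZ hg hf mphi.
split.
- rewrite -pos -integral_swap; last exact: measurable_funepos.
  by apply: eq_integral => b _; rewrite !funeposE /h /= /p joint_density_swap.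
- rewrite -tot -integral_swap//.
  by apply: eq_integral => b _; rewrite /h /= /p joint_density_swap.
Qed.

Lemma measurable_information_density : measurable_fun setT J.
Proof.
apply: emeasurable_funM => //; apply: measurableT_comp (@measurable_lne R) _.
apply: emeasurable_funM => //; apply: measurableT_comp (@measurable_inve R) _.
exact: emeasurable_funM.
Qed.

(** Densities are integrals over z and may be +oo somewhere, but each has total mass 1. The
    pointwise inequalities need finite values. *)
Lemma ae_densities_fin_num : {ae mu1 \x mu2, forall a,
  [/\ p a \is a fin_num, p1 a.1 \is a fin_num & p2 a.2 \is a fin_num]}.
Proof.
have ap : {ae mu1 \x mu2, forall a, p a \is a fin_num}.
  by apply: ae_fin_num => //; rewrite (integral_joint_density pZ hf hg) ltry.
have ap1 : {ae mu1 \x mu2, forall a, p1 a.1 \is a fin_num}.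
  apply: (ae_product_fst mu2 (P := fun x => p1 x \is a fin_num)).
  apply: ae_fin_num => //; rewrite [ltLHS](_ : _ = 1) ?ltry//.
  exact: integral_marginal_density hf.
have ap2 : {ae mu1 \x mu2, forall a, p2 a.2 \is a fin_num}.
  apply: (ae_product_snd mu1 (P := fun x => p2 x \is a fin_num)).
  apply: ae_fin_num => //; rewrite [ltLHS](_ : _ = 1) ?ltry//.
  exact: integral_marginal_density hg.
by apply: filterS3 ap ap1 ap2.
Qed.

(** Since J >= p - p1 p2 >= - p1 p2 almost everywhere, the negative part is at most p1 p2, of
    integral 1. The mutual information is thus never of the form +oo - +oo. *)
Lemma integral_information_neg_lty : \int[mu1 \x mu2]_a J^\- a < +oo.
Proof.
have p12 : \int[mu1 \x mu2]_a (p1 a.1 * p2 a.2) = 1.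
  rewrite (integral_marginal_mul_kernel (mu2 := mu2) pZ hf
    (k := fun a => p2 a.2))// => a.
  exact: integral_marginal_density hg.
apply: (@le_lt_trans _ _ 1); last exact: ltry.
rewrite -p12; apply: ae_ge0_le_integral => //.
- by apply: measurable_funeneg; exact: measurable_information_density.
- by move=> a _; rewrite mule_ge0.
- exact: emeasurable_funM.
- apply: filterS ae_densities_fin_num => a [pa p1a p2a] _.
  rewrite funenegE ge_max mule_ge0// andbT leeNl.
  apply: le_trans (mul_lne_div_ge pa p1a p2a _ _ _ _ _) => //.
  + by rewrite leeDr.
  + exact: (joint_density_eq0 hf hg (a:=a)).
  + exact: joint_density_eq0_snd.
Qed.

Lemma upper_integrable_information :
    mutual_information mu1 mu2 p p1 p2 < +oo ->
  upper_integrable (mu1 \x mu2) J.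
Proof.
move=> I_lty; split; first exact: measurable_information_density.
move: I_lty integral_information_neg_lty.
have -> : mutual_information mu1 mu2 p p1 p2 =
    \int[mu1 \x mu2]_a J^\+ a - \int[mu1 \x mu2]_a J^\- a.
  exact: integralE.
have : 0 <= \int[mu1 \x mu2]_a J^\- a by exact: integral_ge0.
case: (\int[mu1 \x mu2]_a J^\- a) => [r| |]//.
by case: (\int[mu1 \x mu2]_a J^\+ a) => [t| |]// _ _ _; exact: ltry.
Qed.

(** Upper integrability is part of the conclusion so that the two one-sided bounds can later be
    added by subadditivity. *)
Lemma expectation_lne_kernel_le (q : A1 -> A2 -> R) :
    cond_density mu2 q ->
    mutual_information mu1 mu2 p p1 p2 < +oo ->
    \int[mu2]_b h2^\+ b < +oo ->
  upper_integrable (mu1 \x mu2) (fun a => p a * lne (q a.1 a.2)%:E) /\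
  \int[mu1 \x mu2]_a (p a * lne (q a.1 a.2)%:E) <=
    mutual_information mu1 mu2 p p1 p2 + \int[mu2]_b h2 b.
Proof.
move=> hq I_lty h2_lty.
have mq : measurable_fun setT (fun a : A1 * A2 => (q a.1 a.2)%:E).
  by apply/measurable_EFinP; exact: cond_density_measurable hq.
have q0 x y : (0 <= q x y)%R by exact: cond_density_ge0 hq x y.
pose p1q (a : A1 * A2) := p1 a.1 * (q a.1 a.2)%:E.
have uJ := upper_integrable_information I_lty.
have mlp2 : measurable_fun setT (@lne R \o p2).
  by apply: measurableT_comp => //; exact: measurable_lne.
have [posH totH] := expectation_marginal_snd mlp2.
have uH : upper_integrable (mu1 \x mu2) (fun a => p a * lne (p2 a.2)).
  split; last by rewrite posH.
  by apply: emeasurable_funM => //; exact: measurableT_comp mlp2 _.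
have p1q0 a : 0 <= p1q a by rewrite mule_ge0// lee_fin.
have mp1q : measurable_fun setT p1q by exact: emeasurable_funM.
have Ip1q : \int[mu1 \x mu2]_a p1q a = 1.
  rewrite (integral_marginal_mul_kernel pZ hf
    (k := fun a => (q a.1 a.2)%:E))//.
    by move=> a; rewrite lee_fin.
  by move=> a; exact: (cond_density_norm hq).
have up1q : upper_integrable (mu1 \x mu2) p1q.
  split=> //; under eq_integral => a _ do
    rewrite funeposE (max_l (p1q0 a)).
  by rewrite Ip1q ltry.
have uNp : upper_integrable (mu1 \x mu2) (\- p).
  split; first exact: measurableT_comp.
  under eq_integral => a _ do
    rewrite funeposE max_r ?oppe_le0//.
  by rewrite integral0 ltry.
have [uK IK] := upper_integrableD up1q uNp.
have [uJH IJH] := upper_integrableD uJ uH.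
have [uJHK IJHK] := upper_integrableD uJH uK.
have mqlq : measurable_fun setT (fun a : A1 * A2 => p a * lne (q a.1 a.2)%:E).
  apply: emeasurable_funM => //.
  by apply: measurableT_comp (@measurable_lne R) _.
have le_ae : {ae mu1 \x mu2, forall a, p a * lne (q a.1 a.2)%:E <=
    ((J \+ (fun a => p a * lne (p2 a.2))) \+ (p1q \+ (\- p))) a}.
  apply: filterS ae_densities_fin_num => a [pa p1a p2a] /=.
  apply: mul_lne_le => //.
  - exact: (joint_density_eq0 hf hg (a := a)).
  - exact: joint_density_eq0_snd.
split; first exact: upper_integrable_ae_le uJHK le_ae.
apply: le_trans (ae_le_integral mqlq uJHK.1 le_ae) _.
(* The inserted 0 is the bound for the integral of p1 q - p, at most 1 - 1. *)
apply: le_trans IJHK _; rewrite -[leRHS]adde0; apply: leeD.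
  by apply: le_trans IJH _; rewrite totH.
apply: le_trans IK _; rewrite Ip1q integral_ge0N//.
by rewrite (integral_joint_density pZ hf hg) subee.
Qed.

End one_sided_bound.

(** * Exchange of the agents and finiteness from the entropies *)

Lemma mutual_information_swap (R : realType) dZ d1 d2 (Z : measurableType dZ)
    (A1 : measurableType d1) (A2 : measurableType d2) (pZ : probability Z R)
    (mu1 : {sigma_finite_measure set A1 -> \bar R})
    (mu2 : {sigma_finite_measure set A2 -> \bar R})
    (f : Z -> A1 -> R) (g : Z -> A2 -> R) :
    cond_density mu1 f -> cond_density mu2 g ->
  mutual_information mu2 mu1 (joint_density pZ g f)
    (marginal_density pZ g) (marginal_density pZ f) =
  mutual_information mu1 mu2 (joint_density pZ f g)
    (marginal_density pZ f) (marginal_density pZ g).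
Proof.
move=> hf hg; rewrite /mutual_information -[RHS]integral_swap; last first.
  exact: measurable_information_density hf hg.
by apply: eq_integral => b _; rewrite joint_density_swap [X in _ / X]muleC.
Qed.

(** If the negative part has finite integral, an infinite positive part would make the entropy -oo.
    Existence excludes two infinite parts, whose convention would give entropy +oo. *)
Lemma entropy_gtNy_pos_lty (R : realType) d (A : measurableType d)
    (mu : {sigma_finite_measure set A -> \bar R}) (p : A -> \bar R) :
  entropy_exists mu p -> entropy mu p != -oo ->
  \int[mu]_a (fun a => p a * lne (p a))^\+ a < +oo.
Proof.
pose h a := p a * lne (p a).
case => // hneg.
have -> : entropy mu p = - (\int[mu]_a h^\+ a - \int[mu]_a h^\- a).
  by congr (- _); exact: integralE.
have : 0 <= \int[mu]_a h^\- a by exact: integral_ge0.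
move: hneg; rewrite -/h; case: (\int[mu]_a h^\- a) => [r| |]//.
by case: (\int[mu]_a h^\+ a) => [t| |]// *; exact: ltry.
Qed.
Lemma upper_integrable_swap (R : realType) d1 d2 (A1 : measurableType d1)
    (A2 : measurableType d2) (mu1 : {sigma_finite_measure set A1 -> \bar R})
    (mu2 : {sigma_finite_measure set A2 -> \bar R}) (f : A1 * A2 -> \bar R) :
  upper_integrable (mu1 \x mu2) f ->
  upper_integrable (mu2 \x mu1) (fun b => f (b.2, b.1)).
Proof.
move=> [mf If]; split.
  exact: (measurableT_comp mf (@measurable_swap _ _ A2 A1)).
rewrite -(integral_swap mu1 mu2 (measurable_funepos mf)) in If.
by under eq_integral do rewrite funeposE -(funeposE f).
Qed.

(** The one-sided bound with the agents exchanged, carried back to [mu1 \x mu2] by swapping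
    coordinates so that it can be added to the other one. *)
Lemma expectation_lne_kernel_le_fst (R : realType) dZ d1 d2
    (Z : measurableType dZ) (A1 : measurableType d1) (A2 : measurableType d2)
    (pZ : probability Z R) (mu1 : {sigma_finite_measure set A1 -> \bar R})
    (mu2 : {sigma_finite_measure set A2 -> \bar R})
    (f : Z -> A1 -> R) (g : Z -> A2 -> R) (q : A2 -> A1 -> R) :
    cond_density mu1 f -> cond_density mu2 g -> cond_density mu1 q ->
  let p := joint_density pZ f g in
  let p1 := marginal_density pZ f in
  let p2 := marginal_density pZ g in
    mutual_information mu1 mu2 p p1 p2 < +oo ->
    \int[mu1]_a (fun a => p1 a * lne (p1 a))^\+ a < +oo ->
  upper_integrable (mu1 \x mu2) (fun a => p a * lne (q a.2 a.1)%:E) /\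
  \int[mu1 \x mu2]_a (p a * lne (q a.2 a.1)%:E) <=
    mutual_information mu1 mu2 p p1 p2 + \int[mu1]_a (p1 a * lne (p1 a)).
Proof.
move=> hf hg hq p p1 p2.
rewrite -(mutual_information_swap pZ hf hg) => I_lty h1_lty.
have [uE leE] := expectation_lne_kernel_le hg hf hq I_lty h1_lty.
have E a : p a * lne (q a.2 a.1)%:E =
    joint_density pZ g f (a.2, a.1) * lne (q a.2 a.1)%:E.
  by rewrite joint_density_swap.
split.
  under eq_fun do rewrite E.
  exact: (upper_integrable_swap uE).
under eq_integral do rewrite E.
rewrite (integral_swap mu2 mu1
  (f := fun b => joint_density pZ g f b * lne (q b.1 b.2)%:E))//.
exact: uE.1.
Qed.

(** * Extended arithmetic and the symmetrized bound *)

Lemma half_muleNy (R : realType) : (2^-1 : R)%:E * -oo = -oo :> \bar R.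
Proof. by rewrite gt0_muleNy// lte_fin invr_gt0. Qed.

(** [h1] and [h2] stand for integrals of p log p, the opposites of entropies. Every infinite case
    makes the left-hand side -oo: a value +oo of [h1] or [h2] contributes -oo, and a value -oo
    without it forces E = -oo, which absorbs +oo. *)
Lemma half_sub_le (R : realType) (I h1 h2 E : \bar R) :
  I < +oo -> E <= (I + h2) + (I + h1) -> (2^-1)%:E * (- h1 - h2 + E) <= I.
Proof.
case: I h1 h2 E => [I| |] [h1| |] [h2| |] [E| |] //=;
  rewrite ?(addNye, addeNy, half_muleNy, leNye)// => _.
by rewrite -!EFinD -EFinM !lee_fin; lra.
Qed.

(** The logarithm of a real number is never +oo, so the sum of two is never +oo - oo and a finite
    factor distributes. *)
Lemma muleDr_lne (R : realType) (p : \bar R) (x y : R) : p \is a fin_num ->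
  p * (lne x%:E + lne y%:E) = p * lne x%:E + p * lne y%:E.
Proof.
move=> pf; apply: muleDr => //.
by rewrite /lne; case: ifP; case: ifP.
Qed.

Theorem mainTheorem1 (R : realType)
  (Agent : finType) (State : Type)
  (dZ : measure_display) (Z : measurableType dZ) (pZ : probability Z R)
  (dA : Agent -> measure_display) (A : forall k : Agent, measurableType (dA k))
  (mu : forall k : Agent, {sigma_finite_measure set (A k) -> \bar R})
  (pi : forall k : Agent, State -> Z -> A k -> R)
  (pi_density : forall (k : Agent) (s : State), cond_density (mu k) (pi k s))
  (i j : Agent) (neq_ij : i != j) (s : State)
  (qj : State -> A i -> A j -> R) (qi : State -> A j -> A i -> R)
  (qj_density : forall s' : State, cond_density (mu j) (qj s'))
  (qi_density : forall s' : State, cond_density (mu i) (qi s'))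
  (Hi_exists : entropy_exists (mu i) (marginal_density pZ (pi i s)))
  (Hj_exists : entropy_exists (mu j) (marginal_density pZ (pi j s))) :
  (2^-1)%:E *
    (entropy (mu i) (marginal_density pZ (pi i s)) +
     entropy (mu j) (marginal_density pZ (pi j s)) +
     expectation_density (mu i \x mu j)
       (joint_density pZ (pi i s) (pi j s))
       (fun a => lne (qj s a.1 a.2)%:E + lne (qi s a.2 a.1)%:E))
  <= mutual_information (mu i) (mu j)
       (joint_density pZ (pi i s) (pi j s))
       (marginal_density pZ (pi i s)) (marginal_density pZ (pi j s)).
Proof.
have hi := pi_density i s; have hj := pi_density j s.
set p := joint_density _ _ _; set I := mutual_information _ _ _ _ _.
have [I_lty|] := ltP I +oo; last by rewrite leye_eq => /eqP ->; rewrite leey.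
have [HiNy|/(entropy_gtNy_pos_lty Hi_exists) hi_lty] :=
    eqVneq (entropy (mu i) (marginal_density pZ (pi i s))) -oo.
  by rewrite HiNy !addNye half_muleNy leNye.
have [HjNy|/(entropy_gtNy_pos_lty Hj_exists) hj_lty] :=
    eqVneq (entropy (mu j) (marginal_density pZ (pi j s))) -oo.
  by rewrite HjNy addeNy addNye half_muleNy leNye.
have [uj lej] := expectation_lne_kernel_le hi hj (qj_density s) I_lty hj_lty.
have [ui lei] :=
  expectation_lne_kernel_le_fst hi hj (qi_density s) I_lty hi_lty.
have [uE leE] := upper_integrableD uj ui.
(* What remains is to split the expectation of the sum of logarithms: p distributes wherever it is
   finite, then subadditivity applies. *)
apply: half_sub_le => //; apply: le_trans (leeD lej lei).
apply: le_trans leE; apply: ae_le_integral.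
- apply: emeasurable_funM; first exact: measurable_joint_density hi hj.
  apply: emeasurable_funD; apply: measurableT_comp (@measurable_lne R) _;
    apply/measurable_EFinP.
    exact: cond_density_measurable (qj_density s).
  exact: (measurableT_comp (cond_density_measurable (qi_density s))
    (@measurable_swap _ _ (A i) (A j))).
- exact: uE.1.
- apply: filterS (ae_densities_fin_num pZ hi hj) => a [pa _ _].
  by rewrite muleDr_lne.
Qed.
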